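(* Let $m,n$ be relatively prime integers with $1\le m<n$, let $y=e^{2\pi i m/n}$, and let $\phi$ be a complex quadratic cyclic sequence with increment $y$, with defining polynomial $p(x)$. (i) If $n=2k$ is even with $k\ge 2$, then $$p(x)=(x+1)\,\Phi_n(x)\,q(x)$$ for some polynomial $q(x)$ with integer coefficients of degree $\le n-2-\deg\Phi_n(x)$ for which $p(x)$ is legitimate. If $n=2$, then $p(x)=a(x+1)$ for some positive integer $a$. (ii) If $n$ is odd, then $$p(x)=\Phi_n(x)\,q(x)$$ for some polynomial $q(x)$ with integer coefficients of degree $\le n-1-\deg\Phi_n(x)$ for which $p(x)$ is legitimate. If moreover $n$ is prime, then $p(x)=a(x^{n-1}+x^{n-2}+\cdots+x+1)$ for some positive integer $a$. Conversely, every legitimate polynomial $p(x)$ which is of the form $p(x)=(x+1)\,\Phi_n(x)\,q(x)$ with $q(x)$ a polynomial with integer coefficients of degree $\le n-2-\deg\Phi_n(x)$ (when $n\ge 4$ is even), of the form $p(x)=a(x+1)$ with $a$ a positive integer (when $n=2$), or of the form $p(x)=\Phi_n(x)\,q(x)$ with $q(x)$ a polynomial with integer coefficients of degree $\le n-1-\deg\Phi_n(x)$ (when $n$ is odd), yields a corresponding complex quadratic cyclic sequence with increment $y$ and defining polynomial $p(x)$.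
   Context: A *quadratic cyclic sequence (QCS) of order $N\ge2$* is a function $\phi:\mathbb{Z}/N\mathbb{Z}\to\mathbb{C}$ such that for some real constant $\gamma$, for all $j\in\mathbb{Z}/N\mathbb{Z}$, $\frac{\gamma}{2}(2\phi(j)-\phi(j-1)-\phi(j+1))^2=(\phi(j)-\phi(j-1))^2+(\phi(j)-\phi(j+1))^2$. Let $y=e^{2\pi i m/n}$. A *complex QCS with increment $y$* is a QCS whose increments $u_j=\phi(j+1)-\phi(j)$ are, up to multiplication of $\phi$ by a nonzero constant, of the form $u_j=y^{s_j}$ with $s_j\in\{0,\ldots,n-1\}$ and $s_{j+1}\equiv s_j\pm1\pmod n$ for all $j\in\mathbb{Z}/N\mathbb{Z}$. Its *defining polynomial* is $p(x)=b_{n-1}x^{n-1}+\cdots+b_1x+b_0$, where $b_k$ is the number of $j$ with $s_j=k$. A nonzero polynomial $p(x)=b_{n-1}x^{n-1}+\cdots+b_0$ with non-negative integer coefficients is *legitimate* if there is a sequence $(s_j)_{j\in\mathbb{Z}/N\mathbb{Z}}$, $N=\sum_k b_k$, with $s_j\in\{0,\ldots,n-1\}$ and $s_{j+1}\equiv s_j\pm1\pmod n$ for all $j$ (cyclically), in which each $k$ occurs exactly $b_k$ times. $\Phi_n(x)$ is the $n$-th cyclotomic polynomial. *)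

(* Defs.v *)
From mathcomp Require Import all_boot all_order all_algebra all_field.
From mathcomp Require Import complex.
From mathcomp Require Import all_classical all_reals all_analysis.

Set Implicit Arguments.
Unset Strict Implicit.
Unset Printing Implicit Defensive.

Import Order.TTheory GRing.Theory Num.Theory.

Local Open Scope ring_scope.
Local Open Scope complex_scope.

(* Z/NZ is represented by 'I_N with its cyclic successor ordS and predecessor
   ord_pred, rather than by 'Z_N, which is not Z/NZ when N is 0 or 1. *)

Definition expi (R : realType) (theta : R) : R[i] := cos theta +i* sin theta.

(* The constant gamma is real, hence quantified over R and injected in R[i]. *)
Definition qcs (R : realType) (N : nat) (phi : 'I_N -> R[i]) : Prop :=
  (2 <= N)%N /\
  exists gamma : R, forall j : 'I_N,
    gamma%:C / 2 * (2 * phi j - phi (ord_pred j) - phi (ordS j)) ^+ 2 =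
    (phi j - phi (ord_pred j)) ^+ 2 + (phi j - phi (ordS j)) ^+ 2.

Definition cyclic_walk (n N : nat) (s : 'I_N -> 'I_n) : Prop :=
  forall j : 'I_N,
    ((s (ordS j))%:Z = (s j)%:Z + 1 %[mod n])%Z \/
    ((s (ordS j))%:Z = (s j)%:Z - 1 %[mod n])%Z.

Definition occurrences (n N : nat) (s : 'I_N -> 'I_n) (k : 'I_n) : nat :=
  #|[set j : 'I_N | s j == k]|.

Definition has_exponents (R : realType) (n : nat) (y : R[i]) (N : nat)
    (phi : 'I_N -> R[i]) (s : 'I_N -> 'I_n) : Prop :=
  cyclic_walk s /\
  exists2 c : R[i], c != 0 &
    forall j : 'I_N, c * (phi (ordS j) - phi j) = y ^+ s j.

Definition defining_polynomial (n N : nat) (s : 'I_N -> 'I_n) : {poly int} :=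
  \sum_(k < n) (occurrences s k)%:Z *: 'X^k.

(* The normalising constant, hence s, is determined by phi only up to a power
   of y; so p is a defining polynomial of phi if it arises from some admissible
   choice of s. *)
Definition complex_qcs_with_polynomial (R : realType) (n : nat) (y : R[i])
    (N : nat) (phi : 'I_N -> R[i]) (p : {poly int}) : Prop :=
  qcs phi /\
  exists s : 'I_N -> 'I_n, has_exponents y phi s /\ p = defining_polynomial s.

Definition legitimate (n : nat) (p : {poly int}) : Prop :=
  [/\ p != 0, (size p <= n)%N, (forall k : nat, 0 <= p`_k) &
    exists (N : nat) (s : 'I_N -> 'I_n),
      [/\ N%:Z = \sum_(k < n) p`_k, cyclic_walk s &
          forall k : 'I_n, (occurrences s k)%:Z = p`_k]].

(* deg 0 = 0; only degrees of nonzero polynomials matter. *)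
Definition deg (p : {poly int}) : nat := (size p).-1.

(* Main.v *)
Require Import Defs.
From mathcomp Require Import all_boot all_order all_algebra all_field.
From mathcomp Require Import complex.
From mathcomp Require Import all_classical all_reals all_analysis.
From mathcomp Require Import ring lra zify.

(** A sequence phi on the cycle is determined, up to a constant, by its
    increments u_j, and a family of increments comes from some phi exactly when
    its sum vanishes ([sum_cyclic_increments], [cyclic_antiderivative]).  If
    u_j = y^(s_j), that sum is the value at y of the defining polynomial
    p = sum_j x^(s_j) ([horner_defining_polynomial]).  So the exponent sequences
    s that occur are the nonempty cyclic walks with p(y) = 0.

    The quadratic equation gives no further condition.  At each index one of
    the two adjacent increments is y times the other, and, the equation being
    homogeneous and symmetric in them, all of its instances reduce to
    gamma / 2 (1 - y)^2 = 1 + y^2.  Since 1 + y^2 = 2 cos(theta) y for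
    y = e^(i theta), this holds for the real number
    gamma = 2 cos(theta) / (cos(theta) - 1) ([qcs_of_increments]).

    What remains is arithmetic.  The number y is a primitive n-th root of unity
    ([expi_primitive]), and Phi_n is irreducible over the rationals and monic, so
    p(y) = 0 amounts to Phi_n dividing p over the integers ([Cyclotomic_dvd],
    [root_Cyclotomic]).  When n is even each step of the walk changes the parity
    of the exponent; half of the exponents are then even, that is p(-1) = 0
    ([cyclic_walk_parity]), and for n > 2 the factor x + 1 is not one already
    contained in Phi_n ([Cyclotomic_dvd_factor_opp1]).  When n is prime, Phi_n
    is 1 + x + ... + x^(n-1) ([Cyclotomic_prime]), and since p has degree at most
    n - 1 the cofactor is a constant; this covers n = 2 as well. *)

Import Order.TTheory GRing.Theory Num.Theory.

Local Open Scope ring_scope.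
Local Open Scope complex_scope.

(** * Cyclotomic polynomials and divisibility over the integers *)

(** Phi_n is the minimal polynomial of the primitive n-th roots of unity among
    the algebraic numbers, and minimal polynomials are irreducible. *)
Lemma Cyclotomic_irreducible n : (0 < n)%N ->
  irreducible_poly (map_poly intr 'Phi_n : {poly rat}).
Proof.
move=> n_gt0; have [z prim_z] := C_prim_root_exists n_gt0.
have [f [Df mon_f] dv_f] := minCpolyP z.
have <- : f = map_poly intr 'Phi_n.
  apply: (map_poly_inj (ratr : {rmorphism rat -> algC})).
  rewrite -Df (minCpoly_cyclotomic prim_z) -(Cintr_Cyclotomic prim_z).
  by rewrite -map_poly_comp; apply: eq_map_poly => a; rewrite /= ratr_int.
apply/(@subfx_irreducibleP _ _ (ratr : {rmorphism rat -> algC}) z).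
- by rewrite dv_f.
- exact: monic_neq0.
- by move=> q; rewrite dv_f => f_q q_neq0; apply: dvdp_leq.
Qed.

(** A root z of x^n - 1 is a root of Phi_d for some d dividing n; then z^d = 1,
    which for a primitive z forces d = n.  The field is arbitrary because the
    result is applied to complex numbers over an abstract real field. *)
Lemma root_Cyclotomic (F : numFieldType) n (z : F) :
  n.-primitive_root z -> root (map_poly intr 'Phi_n) z.
Proof.
move=> prim_z; have n_gt0 := prim_order_gt0 prim_z.
have : root (map_poly intr ('X^n - 1)) z.
  rewrite /root rmorphB rmorph1 /= map_polyXn !hornerE.
  by rewrite (prim_expr_order prim_z) subrr.
rewrite -prod_Cyclotomic // rmorph_prod /= /root horner_prod prodf_seq_eq0.
case/hasP=> d; rewrite -dvdn_divisors //= => d_dvd_n root_d.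
have d_gt0 := dvdn_gt0 n_gt0 d_dvd_n.
suff /eqP <- : d == n by [].
rewrite eqn_dvd d_dvd_n (prim_order_dvd prim_z) /= -subr_eq0.
have -> : z ^+ d - 1 = (map_poly intr ('X^d - 1)).[z].
  by rewrite rmorphB rmorph1 /= map_polyXn !hornerE.
rewrite -prod_Cyclotomic // (big_rem d) -?dvdn_divisors //=.
by rewrite rmorphM hornerM /= (eqP root_d) mul0r.
Qed.

(** If the remainder of p modulo Phi_n were nonzero, irreducibility of Phi_n and
    the size of the remainder would make p and Phi_n coprime over the
    rationals, hence without common root.  The quotient has integer
    coefficients because Phi_n is monic. *)
Lemma Cyclotomic_dvd (F : numFieldType) n (z : F) (p : {poly int}) :
    n.-primitive_root z -> root (map_poly intr p) z ->
  exists q, p = 'Phi_n * q.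
Proof.
move=> prim_z root_p; have n_gt0 := prim_order_gt0 prim_z.
have intrE (r : {poly int}) :
    map_poly intr r = map_poly ratr (map_poly intr r : {poly rat}) :> {poly F}.
  by rewrite -map_poly_comp; apply: eq_map_poly => a; rewrite /= ratr_int.
have p_eq := Pdiv.IdomainMonic.divp_eq (Cyclotomic_monic n) p.
have [mod_eq0 | mod_neq0] := eqVneq (p %% 'Phi_n) 0.
  by exists (p %/ 'Phi_n); rewrite {1}p_eq mod_eq0 addr0 mulrC.
have : ~~ coprimep (map_poly intr 'Phi_n : {poly rat}) (map_poly intr p).
  apply/negP; rewrite -(coprimep_map (ratr : {rmorphism rat -> F})) -!intrE.
  move=> /coprimep_root/(_ (root_Cyclotomic _ _ _ prim_z)).
  by rewrite -/(root _ _) root_p.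
rewrite irreducible_poly_coprime ?negbK; last exact: Cyclotomic_irreducible.
rewrite {1}p_eq rmorphD rmorphM /= dvdp_addr ?dvdp_mull //.
have mod_rat_neq0 : map_poly intr (p %% 'Phi_n) != 0 :> {poly rat}.
  by rewrite -size_poly_eq0 size_map_inj_poly ?size_poly_eq0 //; exact: intr_inj.
move=> /(dvdp_leq mod_rat_neq0).
rewrite leqNgt !size_map_inj_poly //; try exact: intr_inj.
by rewrite ltn_modp monic_neq0 ?Cyclotomic_monic.
Qed.

(** Both sides times x - 1 equal x^p - 1, as the only divisors of p are 1
    and p. *)
Lemma Cyclotomic_prime p : prime p -> 'Phi_p = \sum_(i < p) 'X^i.
Proof.
move=> p_pr; have p_gt1 := prime_gt1 p_pr.
have divisors_p : perm_eq (divisors p) [:: 1%N; p].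
  apply: uniq_perm; rewrite ?divisors_uniq //= ?inE ?andbT ?ltn_eqF //.
  move=> d; rewrite -dvdn_divisors ?prime_gt0 // !inE.
  by apply/idP/pred2P => [/(proj2 (primeP p_pr))/pred2P | [] ->].
have Phi1 : 'Phi_1 = 'X - 1 by rewrite -(prod_Cyclotomic (n := 1)) // big_seq1.
have := prod_Cyclotomic (prime_gt0 p_pr).
rewrite (perm_big _ divisors_p) big_cons big_seq1 Phi1 subrX1.
by apply: mulfI; rewrite -Phi1 monic_neq0 ?Cyclotomic_monic.
Qed.

Lemma deg_cofactor_le (d : {poly int}) q n :
    d * q != 0 -> (size (d * q)%R <= n)%N -> (deg q <= n - 1 - deg d)%N.
Proof.
rewrite mulf_eq0 => /norP[d_neq0 q_neq0]; rewrite size_mul // /deg.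
move: d_neq0 q_neq0; rewrite -!size_poly_gt0; move: (size d) (size q) => a b; lia.
Qed.

(** The root -1 of the product is not a root of Phi_n, because it has order at
    most 2; so it is a root of the cofactor. *)
Lemma Cyclotomic_dvd_factor_opp1 n (q : {poly int}) :
    (2 < n)%N -> ('Phi_n * q).[-1] = 0 ->
  exists r, 'Phi_n * q = ('X + 1) * 'Phi_n * r.
Proof.
move=> n_gt2; have n_gt0 : (0 < n)%N by exact: leq_trans n_gt2.
have Phi_neq0 : ('Phi_n).[-1] != 0.
  have [z prim_z] := C_prim_root_exists n_gt0.
  apply/negP => /eqP Phi_eq0.
  have := root_cyclotomic prim_z (-1).
  rewrite -(Cintr_Cyclotomic prim_z) /root.
  rewrite -(rmorphN1 (intr : {rmorphism int -> algC})).
  rewrite horner_map /= Phi_eq0 eqxx rmorphN1 => /esym prim_opp1.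
  have := prim_order_dvd prim_opp1 2; rewrite sqrrN expr1n eqxx => /dvdn_leq.
  by move=> /(_ isT); rewrite leqNgt n_gt2.
move/eqP; rewrite hornerM mulf_eq0 (negPf Phi_neq0) /= => /factor_theorem[r ->].
by exists r; rewrite polyCN opprK polyC1; ring.
Qed.

(** * Roots of unity on the complex unit circle *)

Lemma expiD (R : realType) (a b : R) : expi (a + b) = expi a * expi b.
Proof. by rewrite /expi sinD cosD; simpc; rewrite (addrC (sin a * _)). Qed.

Lemma expi0 (R : realType) : expi (0 : R) = 1.
Proof. by rewrite /expi sin0 cos0. Qed.

Lemma expi_natmul (R : realType) (a : R) k : expi (a *+ k) = expi a ^+ k.
Proof. by elim: k => [|k IHk]; rewrite ?mulr0n ?expi0 // mulrS exprS expiD IHk. Qed.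

(** With a = 2b one has cos a = 1 - 2 sin(b)^2, and sin b > 0 because b lies
    strictly between 0 and pi. *)
Lemma cos_neq1 (R : realType) (a : R) : 0 < a < 2 * pi -> cos a != 1.
Proof.
move=> /andP[a_gt0 a_lt]; apply/eqP.
have -> : a = (a / 2) *+ 2 by rewrite -[in RHS]mulr_natr mulfVK ?pnatr_eq0.
have sin_gt0 : 0 < sin (a / 2).
  by apply: sin_gt0_pi; rewrite divr_gt0 // ltr_pdivrMr // mulrC.
have := cos2Dsin2 (a / 2); rewrite cos_mulr2n; nra.
Qed.

(** The order d of e^(2 i pi / n) divides n; if it were smaller than n, the
    angle 2 pi d / n would lie strictly between 0 and 2 pi and have cosine 1. *)
Lemma expi_primitive (R : realType) n : (0 < n)%N ->
  n.-primitive_root (expi (2 * pi / n%:R) : R[i]).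
Proof.
move=> n_gt0; have n_neq0 : n%:R != 0 :> R by rewrite pnatr_eq0 -lt0n.
have [|d prim_d d_dvd] := @prim_order_exists _ n (expi (2 * pi / n%:R : R)) n_gt0.
  rewrite -expi_natmul -[X in expi X]mulr_natr mulfVK // mulr_natl.
  by rewrite /expi cos2pi sin2pi.
have d_gt0 := prim_order_gt0 prim_d.
have := dvdn_leq n_gt0 d_dvd; rewrite leq_eqVlt => /orP[/eqP d_eq | d_lt].
  by rewrite -{1}d_eq.
have := prim_expr_order prim_d; rewrite -expi_natmul => /eqP.
have -> : (2 * pi / n%:R : R) *+ d = 2 * pi * d%:R / n%:R.
  by rewrite -mulrnAl mulr_natr.
rewrite eq_complex /= (negPf (cos_neq1 _ _ _)) //; apply/andP; split.
  by rewrite divr_gt0 ?mulr_gt0 ?pi_gt0 ?ltr0n.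
by rewrite ltr_pdivrMr ?ltr0n // ltr_pM2l ?mulr_gt0 ?pi_gt0 // ltr_nat.
Qed.

(** The characteristic equation of a rotation, whose trace is 2 cos(theta) and
    determinant 1. *)
Lemma expi_quadratic (R : realType) (theta : R) :
  expi theta ^+ 2 + 1 = 2 * (cos theta)%:C * expi theta.
Proof.
rewrite /expi expr2; apply/eqP; rewrite eq_complex /=; simpc.
have := cos2Dsin2 theta; set c := cos _; set d := sin _ => h.
apply/andP; split; apply/eqP; lra.
Qed.

(** * Cyclic walks and their defining polynomials *)

Lemma coef_defining_polynomial n N (s : 'I_N -> 'I_n) (k : 'I_n) :
  (defining_polynomial s)`_k = (occurrences s k)%:Z.
Proof.
rewrite /defining_polynomial coef_sum (bigD1 k) //= coefZ coefXn eqxx mulr1.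
rewrite big1 ?addr0 // => i /negPf i_neq.
by rewrite coefZ coefXn eq_sym [_ == _]i_neq mulr0.
Qed.

Lemma size_defining_polynomial n N (s : 'I_N -> 'I_n) :
  (size (defining_polynomial s) <= n)%N.
Proof.
apply: (leq_trans (size_sum _ _ _)); apply/bigmax_leqP => k _.
by apply: (leq_trans (size_scale_leq _ _)); rewrite size_polyXn.
Qed.

Lemma sum_occurrences n N (s : 'I_N -> 'I_n) : (\sum_(k < n) occurrences s k = N)%N.
Proof.
rewrite -[RHS]card_ord -sum1_card (partition_big s xpredT) //=.
by apply: eq_bigr => k _; rewrite sum1dep_card.
Qed.

(** The dictionary between the polynomial and the walk: grouping the indices j by
    the value of s_j turns the sum of the x^(s_j) into p(x).  It is used at
    x = y for the closing condition and at x = -1 for the parity. *)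
Lemma horner_defining_polynomial (F : comNzRingType) n N (s : 'I_N -> 'I_n) (x : F) :
  (map_poly intr (defining_polynomial s)).[x] = \sum_j x ^+ s j.
Proof.
rewrite rmorph_sum /= horner_sum (partition_big s xpredT) //=.
apply: eq_bigr => k _; rewrite map_polyZ /= map_polyXn hornerZ hornerXn.
rewrite (eq_bigr (fun=> x ^+ k)) => [|j /eqP-> //].
by rewrite big_const iter_addr_0 /occurrences cardsE mulr_natl.
Qed.

Lemma legitimate_defining_polynomial n N (s : 'I_N -> 'I_n) :
  (0 < N)%N -> cyclic_walk s -> legitimate n (defining_polynomial s).
Proof.
move=> N_gt0 walk_s.
have coef_sum_eq : N%:Z = \sum_(k < n) (defining_polynomial s)`_k.
  rewrite -{1}(sum_occurrences _ _ s) -[LHS]natz natr_sum.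
  by apply: eq_bigr => k _; rewrite coef_defining_polynomial natz.
split; first 1 last.
- exact: size_defining_polynomial.
- move=> k; have [k_lt | k_ge] := ltnP k n.
    by rewrite (coef_defining_polynomial _ _ s (Ordinal k_lt)).
  by rewrite nth_default // (leq_trans (size_defining_polynomial _ _ _)).
- exists N, s; split=> // k; exact/esym/coef_defining_polynomial.
apply: contraTneq N_gt0 => p_eq0.
by move: coef_sum_eq; rewrite p_eq0 big1 => [[->]|i _] //; rewrite coef0.
Qed.

Lemma legitimate_walk n p : legitimate n p ->
  exists N (s : 'I_N -> 'I_n),
    [/\ (0 < N)%N, cyclic_walk s & p = defining_polynomial s].
Proof.
case=> p_neq0 size_p _ [N [s [_ walk_s occ_s]]].
have p_eq : p = defining_polynomial s.
  apply/polyP => k; have [k_lt | k_ge] := ltnP k n.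
    by rewrite (coef_defining_polynomial _ _ s (Ordinal k_lt)) occ_s.
  rewrite !nth_default // ?(leq_trans (size_defining_polynomial _ _ _)) //.
  exact: leq_trans size_p k_ge.
exists N, s; split=> //; case: N s {walk_s occ_s} p_eq => // s p_eq.
case/eqP: p_neq0; rewrite p_eq /defining_polynomial big1 // => k _.
by rewrite /occurrences eq_card0 ?scale0r // => -[].
Qed.

(** The exponents of a walk are residues modulo n, so x^n = 1 is what makes a step
    s_j + 1 or s_j - 1 act on x^(s_j).  The step down is written without an
    inverse, so that x may live in any ring. *)
Lemma cyclic_walk_exp (F : nzRingType) (x : F) n N (s : 'I_N -> 'I_n) j :
    x ^+ n = 1 -> cyclic_walk s ->
  x ^+ s (ordS j) = x * x ^+ s j \/ x ^+ s j = x * x ^+ s (ordS j).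
Proof.
move=> xn1; have exp_mod a b : (a%:Z == b%:Z + 1 %[mod n])%Z -> x ^+ a = x * x ^+ b.
  rewrite -[b%:Z + 1]/((b + 1)%N%:Z) !modz_nat => /eqP[eq_mod].
  by rewrite -exprS -(expr_mod _ xn1) eq_mod (expr_mod _ xn1) addn1.
case/(_ j)=> /eqP s_eq; [left | right]; apply: exp_mod => //.
by move: s_eq; rewrite -(eqz_modDr 1) subrK eq_sym.
Qed.

(** As (-1)^n = 1, the sign (-1)^(s_j) changes at every step; shifting the index
    therefore shows that the sum of these signs is its own opposite. *)
Lemma cyclic_walk_parity n N (s : 'I_N -> 'I_n) :
  ~~ odd n -> cyclic_walk s -> (defining_polynomial s).[-1] = 0.
Proof.
move=> n_even walk_s; have exp_n : (-1) ^+ n = 1 :> int.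
  by rewrite -signr_odd (negPf n_even).
have <- : map_poly intr (defining_polynomial s) = defining_polynomial s.
  by apply: map_poly_id => a _; rewrite /= intz.
rewrite horner_defining_polynomial.
suff : \sum_j (-1) ^+ s j = - (\sum_j (-1) ^+ s j) :> int.
  by move/eqP; rewrite -addr_eq0 -mulr2n mulrn_eq0 /= => /eqP.
rewrite [LHS](reindex_inj (@ordS_inj N)) -sumrN; apply: eq_bigr => j _.
have [-> | ->] := cyclic_walk_exp _ _ _ _ s j exp_n walk_s;
  by rewrite ?mulN1r ?opprK.
Qed.

(** * Sequences on the cycle and their increments *)

Lemma sum_cyclic_increments (V : zmodType) N (f : 'I_N -> V) :
  \sum_j (f (ordS j) - f j) = 0.
Proof. by rewrite sumrB [X in _ - X](reindex_inj (@ordS_inj N)) subrr. Qed.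

(** The partial sums work away from the wrap-around index, and there the
    hypothesis closes the cycle. *)
Lemma cyclic_antiderivative (V : zmodType) N (u : 'I_N -> V) :
  \sum_j u j = 0 -> exists f : 'I_N -> V, forall j, f (ordS j) - f j = u j.
Proof.
move=> sum_u; exists (fun j : 'I_N => \sum_(i < N | (i < j)%N) u i) => j /=.
have split_j : \sum_(i < N | (i < j.+1)%N) u i = u j + \sum_(i < N | (i < j)%N) u i.
  rewrite (bigD1 j) //=; congr (_ + _); apply: eq_bigl => i.
  by rewrite ltnS -val_eqE /= andbC -ltn_neqAle.
(* The successor of j is j + 1 modulo N, so the last index is special. *)
have [j_lt | j_ge] := ltnP j.+1 N; first by rewrite modn_small // split_j addrK.
have j_eq : j.+1 = N by apply/eqP; rewrite eqn_leq j_ge ltn_ord.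
rewrite j_eq modnn big_pred0 //.
apply/eqP; rewrite sub0r eq_sym -addr_eq0 -split_j -[X in _ == X]sum_u.
by apply/eqP/eq_bigl => i; rewrite j_eq ltn_ord.
Qed.

(** The hypothesis does not say which of two consecutive increments is y times the
    other, as the walk may go up or down; the quadratic equation is symmetric in
    them, so both cases follow from gamma / 2 (1 - y)^2 = 1 + y^2. *)
Lemma qcs_of_increments (R : realType) (theta : R) N (phi : 'I_N -> R[i]) :
    (2 <= N)%N -> cos theta != 1 ->
    (forall j, let u := phi (ordS j) - phi j in
       let v := phi (ordS (ordS j)) - phi (ordS j) in
       v = expi theta * u \/ u = expi theta * v) ->
  qcs phi.
Proof.
move=> N_ge2 cos_ne1 step; split=> //.
pose gamma := 2 * cos theta / (cos theta - 1); exists gamma => j.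
set y := expi theta in step.
have key : gamma%:C / 2 * (1 - y) ^+ 2 = 1 + y ^+ 2.
  have y2 := expi_quadratic _ theta; rewrite -/y in y2.
  have -> : (1 - y) ^+ 2 = 2 * ((cos theta)%:C - 1) * y.
    by transitivity ((y ^+ 2 + 1) - 2 * y); [ring | rewrite y2; ring].
  have cos_neq0 : (cos theta)%:C - 1 != 0 :> R[i].
    by apply: contra cos_ne1; rewrite subr_eq0 eq_complex /= => /andP[].
  have -> : gamma%:C = 2 * (cos theta)%:C / ((cos theta)%:C - 1).
    by rewrite /gamma rmorphM fmorphV rmorphM rmorphB rmorph1 rmorph_nat.
  by rewrite [1 + _]addrC y2; field.
have := step (ord_pred j); rewrite ord_predK /=.
(* Expressing one increment as y times the other makes both sides multiples of
   the square of the latter. *)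
set a := phi (ord_pred j); set b := phi (ordS j); set c := phi j.
case=> uv.
  have -> : b = c + y * (c - a) by rewrite -uv; ring.
  transitivity ((gamma%:C / 2 * (1 - y) ^+ 2) * (c - a) ^+ 2); first by ring.
  by rewrite key; ring.
have -> : a = c - y * (b - c) by rewrite -uv; ring.
transitivity ((gamma%:C / 2 * (1 - y) ^+ 2) * (b - c) ^+ 2); first by ring.
by rewrite key; ring.
Qed.

Theorem theorem8 (R : realType) (m n : nat)
    (hm : (1 <= m)%N) (hmn : (m < n)%N) (hco : coprime m n) :
  let y : R[i] := expi (2 * pi * m%:R / n%:R) in
  (forall (N : nat) (phi : 'I_N -> R[i]) (p : {poly int}),
      complex_qcs_with_polynomial n y phi p ->
      [/\ (forall k : nat, n = (2 * k)%N -> (2 <= k)%N ->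
             exists q : {poly int},
               [/\ p = ('X + 1) * 'Phi_n * q,
                   (deg q <= n - 2 - deg 'Phi_n)%N &
                   legitimate n p]),
          (n = 2%N -> exists2 a : int, 0 < a & p = a *: ('X + 1)),
          (odd n ->
             exists q : {poly int},
               [/\ p = 'Phi_n * q,
                   (deg q <= n - 1 - deg 'Phi_n)%N &
                   legitimate n p]) &
          (odd n -> prime n ->
             exists2 a : int, 0 < a & p = a *: \sum_(i < n) 'X^i)])
  /\
  (forall p : {poly int},
      legitimate n p ->
      [\/ [/\ (4 <= n)%N, ~~ odd n &
            exists2 q : {poly int}, p = ('X + 1) * 'Phi_n * q &
              (deg q <= n - 2 - deg 'Phi_n)%N],
          n = 2%N /\ (exists2 a : int, 0 < a & p = a *: ('X + 1)) |
          odd n /\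
            (exists2 q : {poly int}, p = 'Phi_n * q &
              (deg q <= n - 1 - deg 'Phi_n)%N)] ->
      exists (N : nat) (phi : 'I_N -> R[i]),
        complex_qcs_with_polynomial n y phi p).
Proof.
move=> y; have n_gt0 : (0 < n)%N by exact: leq_ltn_trans hmn.
have y_eq : y = expi (2 * pi / n%:R) ^+ m.
  by rewrite /y -expi_natmul -mulrnAl mulr_natr.
have prim_y : n.-primitive_root y.
  by rewrite y_eq prim_root_exp_coprime ?expi_primitive.
split=> [N phi p [[N_ge2 _] [s [[walk_s [c c_neq0 incr]] p_def]]] | p legit_p].
  have legit_p : legitimate n p.
    rewrite p_def; apply: legitimate_defining_polynomial => //; exact: ltnW.
  have [p_neq0 size_p p_ge0 _] := legit_p.
  have root_p : root (map_poly intr p) y.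
    rewrite p_def /root horner_defining_polynomial -(eq_bigr _ (fun j _ => incr j)).
    by rewrite -mulr_sumr sum_cyclic_increments mulr0.
  have [q p_eq] := Cyclotomic_dvd _ _ _ _ prim_y root_p.
  have deg_q : (deg q <= n - 1 - deg 'Phi_n)%N.
    by apply: deg_cofactor_le; rewrite -p_eq.
  have p_prime : prime n -> exists2 a : int, 0 < a & p = a *: \sum_(i < n) 'X^i.
    move=> n_pr; have := deg_q.
    rewrite /deg size_Cyclotomic totient_prime // subn1 /= subnn leqn0.
    rewrite -subn1 subn_eq0 => /size1_polyC q_eq; exists q`_0; last first.
      by rewrite p_eq q_eq coefC eqxx Cyclotomic_prime // mulrC mul_polyC.
    (* Phi_n is monic, so the constant is the leading coefficient of p. *)
    have lead_p : lead_coef p = q`_0.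
      rewrite p_eq lead_coefM (monicP (Cyclotomic_monic n)) mul1r.
      by rewrite q_eq lead_coefC coefC.
    by rewrite lt_neqAle -lead_p eq_sym lead_coef_eq0 p_neq0 p_ge0.
  split=> //.
  - move=> k n_eq k_ge2.
    have [r r_eq] : exists r, 'Phi_n * q = ('X + 1) * 'Phi_n * r.
      apply: Cyclotomic_dvd_factor_opp1; first by rewrite n_eq; lia.
      by rewrite -p_eq p_def cyclic_walk_parity // n_eq mul2n odd_double.
    exists r; rewrite -r_eq -p_eq; split=> //.
    have : (deg r <= n - 1 - deg (('X + 1) * 'Phi_n))%N.
      by apply: deg_cofactor_le; rewrite -r_eq -p_eq.
    rewrite /deg size_Mmonic ?Cyclotomic_monic ?monic_neq0 ?monicXaddC //.
    by rewrite size_XaddC size_Cyclotomic; move: (size r) => size_r; lia.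
  (* For n = 2 the statement is the prime case. *)
  - move=> n_eq; have [|a a_gt0 ->] := p_prime; first by rewrite n_eq.
    by exists a; rewrite // n_eq big_ord_recl big_ord1 /= addrC.
  - by move=> _; exists q.
have [N [s [N_gt0 walk_s p_eq]]] := legitimate_walk _ _ legit_p.
move=> shape.
have root_p : root (map_poly intr p) y.
  suff [q ->] : exists q, p = 'Phi_n * q.
    by rewrite rmorphM rootM root_Cyclotomic.
  case: shape => [[_ _ [q ->]] | [n_eq [a _ ->]] | [_ [q -> _]]].
  - by exists (('X + 1) * q); ring.
  - exists a%:P; rewrite n_eq Cyclotomic_prime // big_ord_recl big_ord1 /=.
    by rewrite -mul_polyC expr0 expr1; ring.
  - by exists q.
(* A walk of length 1 would have a single power of y as its sum. *)
have N_ge2 : (1 < N)%N.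
  case: N s N_gt0 p_eq {walk_s} => [|[|N]] // s _ p_eq.
  move: root_p; rewrite p_eq /root horner_defining_polynomial big_ord1 expf_eq0.
  by rewrite (prim_root_eq0 prim_y) eqn0Ngt n_gt0 andbF.
have [phi incr] : exists phi : 'I_N -> R[i],
    forall j, phi (ordS j) - phi j = y ^+ s j.
  apply: cyclic_antiderivative; rewrite -horner_defining_polynomial -p_eq.
  exact/eqP.
exists N, phi; split.
  apply: (@qcs_of_increments _ (2 * pi * m%:R / n%:R)) => // [|j /=].
    apply: cos_neq1; apply/andP; split.
      by rewrite divr_gt0 ?mulr_gt0 ?pi_gt0 ?ltr0n.
    by rewrite ltr_pdivrMr ?ltr0n // ltr_pM2l ?mulr_gt0 ?pi_gt0 // ltr_nat.
  by rewrite !incr; apply: cyclic_walk_exp walk_s; exact: prim_expr_order.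
exists s; split=> //; split=> //; exists 1; first exact: oner_neq0.
by move=> j; rewrite mul1r.
Qed.
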